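(* Let $\mathcal J_i$ and $\mathcal K_i\subseteq\mathcal J_i$ be finite index sets and $\mathbb U\subseteq\mathbb R^d$. Let $a_{ij}\in\mathbb R^d$, $b_{ij}\in\mathbb R$ for $j\in\mathcal J_i$, and $\tilde a_{ik}\in\mathbb R^d$, $\tilde b_{ik}\in\mathbb R$ for $k\in\mathcal K_i$. Define $$\mathcal U_i=\{u\in\mathbb U: a_{ij}^\top u\ge b_{ij}\ \forall j\in\mathcal J_i\},\qquad \widetilde{\mathcal U}_i=\{u\in\mathbb U:\tilde a_{ik}^\top u\ge\tilde b_{ik}\ \forall k\in\mathcal K_i\}.$$ If for every $j\in\mathcal J_i$ there exists $\lambda_j=(\lambda_{jk})_{k\in\mathcal K_i}\in\mathbb R_{\ge0}^{|\mathcal K_i|}$ such that $$a_{ij}=\sum_{k\in\mathcal K_i}\lambda_{jk}\tilde a_{ik},\qquad \sum_{k\in\mathcal K_i}\lambda_{jk}\tilde b_{ik}\ge b_{ij},$$ then $\widetilde{\mathcal U}_i\subseteq\mathcal U_i$.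
   Context: In the application, the $a_{ij}^\top u\ge b_{ij}$ are the full safety halfspaces of agent $i$ and the $\tilde a_{ik}^\top u\ge\tilde b_{ik}$ are the retained (reduced) ones. *)

(* Defs.v *)
From mathcomp Require Export all_boot all_order all_algebra.
From mathcomp Require Export classical_sets reals.
Set Implicit Arguments.
Unset Strict Implicit.
Unset Printing Implicit Defensive.
Import Order.TTheory GRing.Theory Num.Theory.
Local Open Scope ring_scope.
Local Open Scope classical_set_scope.

(* The scalar a^T u is the unique entry of the 1 x 1 matrix product.
   Values of a and b at indices outside J are not used. *)
Definition halfspace_set (R : realType) (d : nat) (I : finType)
    (U : set 'cV[R]_d) (J : {set I}) (a : I -> 'cV[R]_d) (b : I -> R) :
    set 'cV[R]_d :=
  [set u | U u /\ forall j, j \in J -> ((a j)^T *m u) 0 0 >= b j].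

(* Main.v *)
Require Import Defs.
Import Order.TTheory GRing.Theory Num.Theory.
Local Open Scope ring_scope.
Local Open Scope classical_set_scope.

Theorem lemma1 (R : realType) (d : nat) (I : finType) (J K : {set I})
    (U : set 'cV[R]_d)
    (a : I -> 'cV[R]_d) (b : I -> R)
    (a' : I -> 'cV[R]_d) (b' : I -> R)
    (hKJ : K \subset J)
    (hcert : forall j : I, j \in J ->
       exists lambda : I -> R,
         [/\ forall k, k \in K -> 0 <= lambda k,
             a j = \sum_(k in K) lambda k *: a' k
           & \sum_(k in K) lambda k * b' k >= b j]) :
  halfspace_set U K a' b' `<=` halfspace_set U J a b.
Proof.
move=> u [Uu hu]; split=> // j /hcert [lambda [lambda_ge0 -> leb]].
(* This is the easy direction of Farkas' lemma: it remains to bound the sum of [lambda k * b' k] by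
   the conic combination of the [a' k] evaluated at [u]. *)
apply: le_trans leb _.
(* Evaluation at [u] is linear in the normal vector, so the bound splits into one inequality per [k]
   in [K]. *)
rewrite linear_sum mulmx_suml summxE; apply: ler_sum => k kK.
rewrite linearZ -scalemxAl mxE.
(* The sign of [lambda k] preserves the direction of the retained inequality. *)
exact: ler_wpM2l (lambda_ge0 k kK) _ _ (hu k kK).
Qed.
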